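(* Let $\mathfrak g$ be a unimodular, $2$-step solvable, completely solvable Lie algebra endowed with a solvable complex structure $J$ and admitting an SKT metric compatible with $J$. Then $\mathfrak g$ is nilpotent. Consequently, any unimodular, $2$-step solvable, completely solvable Lie algebra $\mathfrak g$ endowed with a complex structure $J$ and admitting a compatible SKT metric satisfies $$\mathfrak g=\mathfrak{aff}(\mathbb R)^p\ltimes\mathfrak n_J$$ for some $p\ge 0$.
   Context: All Lie algebras are finite-dimensional and real. A complex structure on $\mathfrak g$ is $J\in\mathrm{End}(\mathfrak g)$ with $J^2=-\mathrm{Id}$ and $[X,Y]+J[JX,Y]+J[X,JY]-[JX,JY]=0$ for all $X,Y$. $2$-step solvable means $[\mathfrak g',\mathfrak g']=0$ with $\mathfrak g'=[\mathfrak g,\mathfrak g]$; unimodular means $\mathrm{tr}(\mathrm{ad}_X)=0$ for all $X$; completely solvable means solvable with all eigenvalues of $\mathrm{ad}_X$ real for every $X$. $J$ is solvable if the series $\mathfrak g^{[0]}(J)=\mathfrak g$, $\mathfrak g^{[j+1]}(J)=[\mathfrak g^{[j]}(J),\mathfrak g^{[j]}(J)]+J[\mathfrak g^{[j]}(J),\mathfrak g^{[j]}(J)]$ reaches $0$. An SKT metric compatible with $J$ is an inner product $g$ on $\mathfrak g$ with $g(J\cdot,J\cdot)=g(\cdot,\cdot)$ such that $\omega=g(J\cdot,\cdot)$ satisfies $dd^c\omega=0$, with $d$ the Chevalley–Eilenberg differential and $d^c=J^{-1}dJ$. $\mathfrak n$ is the nilradical (maximal nilpotent ideal) of $\mathfrak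 g$ and $\mathfrak n_J=\mathfrak n\cap J\mathfrak n$ (here the maximal $J$-invariant nilpotent ideal). $\mathfrak{aff}(\mathbb R)=\langle X,JX\rangle$ with $[JX,X]=X$. The displayed decomposition means that $\mathfrak n_J$ is an ideal and that $\mathfrak g$ is the vector space direct sum of $\mathfrak n_J$ and a $J$-invariant subalgebra holomorphically isomorphic to the direct sum of $p$ copies of $\mathfrak{aff}(\mathbb R)$. *)

(* Defs.v *)
From HB Require Import structures.
From mathcomp Require Import all_boot all_order all_algebra.
From mathcomp Require Import reals complex ring.

Set Implicit Arguments.
Unset Strict Implicit.
Unset Printing Implicit Defensive.

Import Order.TTheory GRing.Theory Num.Theory.
Local Open Scope ring_scope.

HB.mixin Record Vector_isLie (R : fieldType) g of Vector R g := {
  lie : g -> g -> g;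
  lie_bilinear_subproof : bilinear_for *:%R *:%R lie;
  liexx : forall x, lie x x = 0;
  jacobi : forall x y z,
    lie x (lie y z) + lie y (lie z x) + lie z (lie x y) = 0
}.

#[short(type="lieAlgType")]
HB.structure Definition LieAlg (R : fieldType) :=
  {g of Vector R g & Vector_isLie R g}.

HB.instance Definition _ (R : fieldType) (g : lieAlgType R) :=
  bilinear_isBilinear.Build R g g g *:%R *:%R (@lie R g) lie_bilinear_subproof.

Section LieTheory.
Variables (R : fieldType) (g : lieAlgType R).
Implicit Types (U V W I h : {vspace g}) (x y z : g) (J : 'End(g)).

Definition ad x : 'End(g) := linfun (lie x).

(* The span of all brackets of an element of U with an element of V; by
   bilinearity it is enough to bracket two bases, as in falgebra.prodv. *)
Definition liev U V : {vspace g} :=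
  <<[seq lie u v | u <- vbasis U, v <- vbasis V]>>%VS.

Lemma lievP U V W :
  reflect (forall u v, u \in U -> v \in V -> lie u v \in W) (liev U V <= W)%VS.
Proof.
apply: (iffP idP) => [sUVW u v Uu Vv | sUVW].
  rewrite (coord_vbasis Uu) (coord_vbasis Vv) linear_sumlz.
  apply: memv_suml => i _; rewrite linear_sumr; apply: memv_suml => j _.
  rewrite linearZr_LR linearZl_LR; do 2!apply: memvZ.
  apply: (subvP sUVW); apply: memv_span.
  by apply: allpairs_f; rewrite mem_nth ?size_tuple.
apply/span_subvP => _ /allpairsP[[u v] /= [Uu Vv ->]].
by apply: sUVW; apply: vbasis_mem.
Qed.

Definition derived : {vspace g} := liev fullv fullv.
Definition two_step_solvable : Prop := liev derived derived = 0%VS.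

Definition derived_series (k : nat) : {vspace g} :=
  iter k (fun V => liev V V) fullv.
Definition lie_solvable : Prop := exists k, derived_series k = 0%VS.

Definition is_subalgebra h : Prop := (liev h h <= h)%VS.
Definition is_ideal I : Prop := (liev fullv I <= I)%VS.

Definition lower_central h (k : nat) : {vspace g} := iter k (liev h) h.
Definition is_nilpotent h : Prop := exists k, lower_central h k = 0%VS.
Definition lie_nilpotent : Prop := is_nilpotent fullv.

Definition is_nilradical n : Prop :=
  [/\ is_ideal n, is_nilpotent n
    & forall I, is_ideal I -> is_nilpotent I -> (n <= I)%VS -> I = n].

Definition ad_mx x : 'M[R]_(\dim {:g}) :=
  passmx.mxof (vbasis fullv) (vbasis fullv) (ad x).
Definition unimodular : Prop := forall x, \tr (ad_mx x) = 0.

Definition complex_structure J : Prop :=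
  (forall x, J (J x) = - x) /\
  (forall x y, lie x y + J (lie (J x) y) + J (lie x (J y)) - lie (J x) (J y) = 0).

Definition J_series J (k : nat) : {vspace g} :=
  iter k (fun V => liev V V + J @: liev V V)%VS fullv.
Definition J_solvable J : Prop := exists k, J_series J k = 0%VS.

Definition kform (k : nat) := ('I_k -> g) -> R.

(* With j' = lift i j = j.+1 the sum runs over the pairs i < j', and the term is
   (-1) ^ (i + j') a([v_i, v_j'], v_0, .., ^v_i, .., ^v_j', .., v_k+1). *)
Definition CE (k : nat) (a : kform k.+1) : kform k.+2 := fun v =>
  \sum_(i < k.+2) \sum_(j < k.+1 | (i <= j)%N) (-1) ^+ (i + j.+1) *
    a (fun m => if unlift ord0 m is Some l then v (lift i (lift j l))
                else lie (v i) (v (lift i j))).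

Definition pullback (k : nat) (f : 'End(g)) (a : kform k) : kform k :=
  fun v => a (fun m => f (v m)).

Definition dc J (k : nat) (a : kform k.+1) : kform k.+2 :=
  pullback (J^-1)%VF (CE (pullback J a)).

End LieTheory.

Arguments derived {R} g.
Arguments two_step_solvable {R} g.
Arguments lie_solvable {R} g.
Arguments lie_nilpotent {R} g.
Arguments unimodular {R} g.

Definition fundamental_form (R : realFieldType) (g : lieAlgType R)
    (J : 'End(g)) (m : {dot g for idfun}) : kform g 2 :=
  fun v => m (J (v ord0)) (v ord_max).

Definition SKT (R : realFieldType) (g : lieAlgType R)
    (J : 'End(g)) (m : {dot g for idfun}) : Prop :=
  (forall x y, m (J x) (J y) = m x y) /\
  (forall v, CE (dc J (fundamental_form J m)) v = 0).

(* The eigenvalues of ad_x are its complex ones, i.e. those of its real matrix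
   seen as a matrix over R[i]. *)
Definition completely_solvable (R : realType) (g : lieAlgType R) : Prop :=
  lie_solvable g /\
  forall (x : g) (z : R[i]),
    eigenvalue (map_mx (real_complex R) (ad_mx x)) z -> complex.Im z = 0.

(* (a, b) stands for a X + b JX, with [JX, X] = X. *)
Definition aff (R : fieldType) : Type := (R^o * R^o)%type.

Section Aff.
Variable R : fieldType.
HB.instance Definition _ := Vector.on (aff R).

Definition aff_lie (u v : aff R) : aff R := (u.2 * v.1 - u.1 * v.2, 0).

Let aff_bilinear : bilinear_for *:%R *:%R aff_lie.
Proof.
by split=> [[a b] k [c d] [e f] | [a b] k [c d] [e f]];
  congr pair; rewrite /= ?scaler0 ?addr0 // /GRing.scale /=; ring.
Qed.

Let aff_liexx u : aff_lie u u = 0.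
Proof. by congr pair; rewrite mulrC subrr. Qed.

Let aff_jacobi u v w : aff_lie u (aff_lie v w) + aff_lie v (aff_lie w u)
  + aff_lie w (aff_lie u v) = 0.
Proof. by congr pair; rewrite /= ?addr0 //; ring. Qed.

HB.instance Definition _ :=
  Vector_isLie.Build R (aff R) aff_bilinear aff_liexx aff_jacobi.

Definition aff_J (u : aff R) : aff R := (- u.2, u.1).

End Aff.

Section DirectSum.
Variables (R : fieldType) (I : finType) (g : lieAlgType R).

Definition ffun_lie (u v : {ffun I -> g}) : {ffun I -> g} :=
  [ffun i => lie (u i) (v i)].

Let ffun_bilinear : bilinear_for *:%R *:%R ffun_lie.
Proof.
by split=> [u k v w | u k v w]; apply/ffunP=> i;
  rewrite !ffunE ?linearPl ?linearPr.
Qed.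

Let ffun_liexx u : ffun_lie u u = 0.
Proof. by apply/ffunP=> i; rewrite !ffunE liexx. Qed.

Let ffun_jacobi u v w : ffun_lie u (ffun_lie v w) + ffun_lie v (ffun_lie w u)
  + ffun_lie w (ffun_lie u v) = 0.
Proof. by apply/ffunP=> i; rewrite !ffunE jacobi. Qed.

HB.instance Definition _ :=
  Vector_isLie.Build R {ffun I -> g} ffun_bilinear ffun_liexx ffun_jacobi.

End DirectSum.

Definition affp (R : fieldType) (p : nat) : lieAlgType R := {ffun 'I_p -> aff R}.
Definition affp_J (R : fieldType) (p : nat) (u : affp R p) : affp R p :=
  [ffun i => aff_J (u i)].

Section Decomposition.
Variables (R : fieldType) (g : lieAlgType R) (J : 'End(g)).

Definition holomorphic_affp (p : nat) (h : {vspace g}) : Prop :=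
  exists f : 'Hom(affp R p, g),
    [/\ lker f = 0%VS, limg f = h,
        forall u v, f (lie u v) = lie (f u) (f v)
      & forall u, f (affp_J u) = J (f u)].

Definition affp_semidirect (p : nat) (n : {vspace g}) : Prop :=
  is_ideal n /\
  exists h : {vspace g},
    [/\ is_subalgebra h, (J @: h <= h)%VS, holomorphic_affp p h,
        (h + n = fullv)%VS & (h :&: n = 0)%VS].

End Decomposition.

(* Main.v *)
(* Let A = [g, g], which is abelian, and AJ = A cap JA. By integrability the product
   z w = [Jz, w] makes A / AJ a commutative associative algebra, and the operators
   ad y on A commute with real eigenvalues, so there are plenty of joint
   eigenvectors x, with weights l : g -> R. The SKT equation is only evaluated on
   quadruples (z, Jz, q, Jq) and (x, Jx, y, Jy) with x a joint eigenvector; it gives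
   sums of squares that force l(Jz)^2 = - l(J(z z)) / 2 for weights on AJ, and
   exclude nilpotents next to idempotents in A / AJ.
   Take a maximal family X_1, ..., X_p of joint eigenvectors in A such that
   [JX_i, X_j] = delta_ij X_j, with weights l_i. The X_i and JX_i span aff(R)^p, and
   m = {y | l_i(y) = l_i(Jy) = 0 for all i} is a J-invariant ideal complementing it.
   Every character of A / AJ is one of the l_i(J .), from which the SKT equation
   yields that all weights vanish on m. Hence m is nilpotent and equals n cap Jn; if
   J is solvable then p = 0, as all X_i lie in every term of the J-series. *)

Require Import Defs.
From HB Require Import structures.
From mathcomp Require Import all_boot all_order all_algebra.
From mathcomp Require Import reals complex ring lra boolp.

Set Implicit Arguments.
Unset Strict Implicit.
Unset Printing Implicit Defensive.

Import Order.TTheory GRing.Theory Num.Theory.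
Local Open Scope ring_scope.

(** * Linear algebra *)

Lemma vspace_chain_stationary (F : fieldType) (V : vectType F)
    (U : nat -> {vspace V}) :
  (forall k, (U k.+1 <= U k)%VS) -> exists k, U k.+1 = U k.
Proof.
move=> dU; suff : forall n, (exists k, U k.+1 = U k) \/ (\dim (U n) + n <= \dim (U 0%N))%N.
  by case/(_ (\dim (U 0%N)).+1) => //; rewrite addnS ltnNge leq_addl.
elim=> [|n [?|IH]]; [by right; rewrite addn0 | by left |].
case: (eqVneq (U n.+1) (U n)) => [e|ne]; first by left; exists n.
by right; rewrite addnS -addSn (leq_trans _ IH) // leq_add2r
  (ltn_leqif (dimv_leqif_eq (dU n))).
Qed.

Section EndoStable.
Variables (F : fieldType) (V : vectType F) (f : 'End(V)).
Implicit Types (S U : {vspace V}) (v : V).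

(** Stated on invariant subspaces so that it passes to restrictions; it amounts to [f] being
    triangularisable over [F]. *)
Definition has_eigenvectors : Prop := forall S, S != 0%VS -> (f @: S <= S)%VS ->
  exists a v, [/\ v \in S, v != 0 & f v = a *: v].

Lemma iter_limgP k S v :
  reflect (exists2 u, u \in S & v = iter k f u) (v \in iter k (lfun_img f) S).
Proof.
elim: k v => [|k IH] v /=.
  by apply: (iffP idP) => [Sv|[u Su ->]] //; exists v.
apply: (iffP memv_imgP) => [[u /IH[w Sw ->] ->]|[u Su ->]]; first by exists w.
by exists (iter k f u) => //; apply/IH; exists u.
Qed.

Lemma iter_limg_sub k S : (f @: S <= S)%VS -> (iter k (lfun_img f) S <= S)%VS.
Proof.
move=> fS; elim: k => [|k IH] /=; first exact: subvv.
exact: subv_trans (limgS _ IH) fS.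
Qed.

Lemma limg_stationary S : (f @: S <= S)%VS ->
  exists N, (f @: iter N (lfun_img f) S = iter N (lfun_img f) S)%VS.
Proof.
move=> fS; apply: (vspace_chain_stationary (U := fun k => iter k (lfun_img f) S)).
by elim=> //= k IH; apply: limgS.
Qed.

(** Once the images [f^k S] are stationary from [N] on, [f^N v = f^(N+1) u] with [u] in [S]. *)
Lemma fitting S : (f @: S <= S)%VS ->
  exists N, {in S, forall v, exists2 u, u \in S & iter N f (v - f u) = 0}.
Proof.
move=> fS; have [N eN] := limg_stationary fS; exists N => v Sv.
have : iter N f v \in (f @: iter N (lfun_img f) S)%VS.
  by rewrite eN; apply/iter_limgP; exists v.
case/memv_imgP=> _ /iter_limgP[u Su ->] e; exists u => //.
have linN k (x y : V) : iter k f (x - y) = iter k f x - iter k f y.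
  by elim: k => //= k ->; rewrite linearB.
by rewrite linN e -iterS -iterSr subrr.
Qed.

Hypothesis fP : has_eigenvectors.

(** On the stationary image [f] is bijective, so an eigenvector there would have a nonzero
    eigenvalue; hence this image is zero. *)
Lemma nilpotent_of_eigenvalues S : (f @: S <= S)%VS ->
    (forall a v, v \in S -> v != 0 -> f v = a *: v -> a = 0) ->
  exists N, {in S, forall v, iter N f v = 0}.
Proof.
move=> fS h; have [N eN] := limg_stationary fS; exists N => v Sv.
set U := iter N _ S in eN; case: (eqVneq U 0%VS) => [U0|nU].
  by apply/eqP; rewrite -memv0 -U0; apply/iter_limgP; exists v.
have US : (U <= S)%VS by apply: iter_limg_sub.
have [|a [u [Uu nu fu]]] := fP nU; first by rewrite eN subvv.
have a0 : a = 0 by apply: h fu => //; apply: subvP Uu.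
have : u \in (U :&: lker f)%VS by rewrite memv_cap Uu memv_ker fu a0 scale0r /=.
have -> : (U :&: lker f = 0)%VS.
  by apply/eqP; rewrite -dimv_eq0 -(eqn_add2r (\dim (f @: U))) limg_ker_dim eN.
by rewrite memv0 (negPf nu).
Qed.

End EndoStable.

(** * Real eigenvalues and invariant subspaces *)

Section SplitCharPoly.
Variables (R : realType) (g : lieAlgType R).

Lemma real_char_poly_split n (M : 'M[R]_n) :
    (forall z : R[i], eigenvalue (map_mx (real_complex R) M) z ->
       complex.Im z = 0) ->
  exists s : seq R, char_poly M = \prod_(a <- s) ('X - a%:P).
Proof.
move=> h; set p := char_poly (map_mx (real_complex R) M).
have [r pr] : exists r : seq R[i], p = \prod_(z <- r) ('X - z%:P).
  have [r /=] := closed_field_poly_normal p.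
  by rewrite (monicP (char_poly_monic _)) scale1r; exists r.
exists [seq complex.Re z | z <- r].
apply: (map_poly_inj (real_complex R)).
rewrite map_char_poly -/p pr rmorph_prod big_map.
apply: eq_big_seq => z rz; rewrite rmorphB /= map_polyX map_polyC /=.
suff : complex.Im z = 0 by case: z {rz} => a b /= ->.
apply: h; rewrite eigenvalue_root_char -/p pr.
by rewrite root_prod_XsubC.
Qed.

Lemma mul_factors_char_poly n (M : 'M[R]_n) (s : seq R) (u : 'rV_n) :
    char_poly M = \prod_(a <- s) ('X - a%:P) ->
  foldr (fun a v => v *m M - a *: v) u s = 0.
Proof.
case: n M u => [|n] M u Mp; first exact: thinmx0.
have : u *m horner_mx M (char_poly M) = 0 by rewrite Cayley_Hamilton mulmx0.
rewrite Mp => {Mp} <-; elim: s => [|a s IH] /=.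
  by rewrite big_nil rmorph1 mulmx1.
rewrite big_cons mulrC rmorphM -mulmxE mulmxA -IH /=.
by rewrite rmorphB /= horner_mx_X horner_mx_C mulmxBr mul_mx_scalar.
Qed.

(** By Cayley-Hamilton the real linear factors of the characteristic polynomial, applied one after
    the other, kill a nonzero vector of [S]; the last nonzero vector on the way is an
    eigenvector. *)
Lemma completely_solvable_ad :
  completely_solvable g -> forall y : g, has_eigenvectors (ad y).
Proof.
case=> _ gcs y; have /real_char_poly_split[s sP] := gcs y => S nS yS.
have e_basis := vbasisP {:g}.
have v0 (v : g) : foldr (fun a w => ad y w - a *: w) v s = 0.
  apply/eqP; rewrite -(passmx.rVof_eq0 e_basis); apply/eqP.
  rewrite -(mul_factors_char_poly (passmx.rVof (vbasis fullv) v) sP).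
  elim: s {sP} => //= a s <-.
  by rewrite -(passmx.rVof_app _ e_basis); apply/rowP => i; rewrite !mxE linearB linearZ.
have := memv_pick S; have : vpick S != 0 by rewrite vpick0.
move: (vpick S) (v0 (vpick S)) => v {v0}; elim: s {sP} => [|a s IH] /= e nv Sv.
  by rewrite e eqxx in nv.
have Sw : foldr (fun a w => ad y w - a *: w) v s \in S.
  elim: s {IH e} => //= b s IH.
  by rewrite memvB ?memvZ // (subvP yS) // memv_img.
set w := foldr _ _ _ in e IH Sw.
case: (eqVneq w 0) => [w0|nw]; first exact: IH.
by exists a, w; split=> //; apply/eqP; rewrite -subr_eq0 e.
Qed.

End SplitCharPoly.

(** * Bracket calculus and the abelian derived algebra *)

HB.instance Definition _ (F : fieldType) (g : lieAlgType F) (x : g) :=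
  GRing.isLinear.Build F g g *:%R (lie x) (lie_bilinear_subproof.2 x).

Section LieBasics.
Variables (F : fieldType) (g : lieAlgType F).
Implicit Types (x y z : g) (a : F).

Lemma lieDl x y z : lie (x + y) z = lie x z + lie y z.
Proof. exact: linearDl. Qed.
Lemma lieDr x y z : lie z (x + y) = lie z x + lie z y.
Proof. exact: linearDr. Qed.
Lemma lieNl x z : lie (- x) z = - lie x z.
Proof. exact: linearNl. Qed.
Lemma lieNr x z : lie z (- x) = - lie z x.
Proof. exact: linearNr. Qed.
Lemma lieBl x y z : lie (x - y) z = lie x z - lie y z.
Proof. exact: linearBl. Qed.
Lemma lieBr x y z : lie z (x - y) = lie z x - lie z y.
Proof. exact: linearBr. Qed.
Lemma lieZl a x z : lie (a *: x) z = a *: lie x z.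
Proof. exact: linearZl_LR. Qed.
Lemma lieZr a x z : lie z (a *: x) = a *: lie z x.
Proof. exact: linearZr_LR. Qed.
Lemma lie0l z : lie 0 z = 0. Proof. exact: linear0l. Qed.
Lemma lie0r z : lie z 0 = 0. Proof. exact: linear0r. Qed.

Lemma lie_suml I (r : seq I) (P : pred I) (E : I -> g) z :
  lie (\sum_(i <- r | P i) E i) z = \sum_(i <- r | P i) lie (E i) z.
Proof. exact: linear_sumlz. Qed.

Lemma lie_sumr I (r : seq I) (P : pred I) (E : I -> g) z :
  lie z (\sum_(i <- r | P i) E i) = \sum_(i <- r | P i) lie z (E i).
Proof. exact: linear_sumr. Qed.

Definition lieE := (lieDl, lieDr, lieNl, lieNr, lieZl, lieZr, lie0l, lie0r).

Lemma adE x y : ad x y = lie x y. Proof. by rewrite /ad lfunE. Qed.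

Lemma lieC x y : lie x y = - lie y x.
Proof.
by apply/eqP; rewrite -addr_eq0; have := liexx (x + y);
   rewrite !lieE !liexx add0r addr0 => ->.
Qed.

Lemma lie_leibniz x y z : lie x (lie y z) = lie (lie x y) z + lie y (lie x z).
Proof.
apply/eqP; rewrite -subr_eq0 -(jacobi x y z) (lieC (lie x y)) (lieC x z) lieNr.
by rewrite opprD !opprK addrA addrAC.
Qed.

Lemma mem_derived x y : lie x y \in derived g.
Proof. by have /lievP := subvv (derived g); apply; apply: memvf. Qed.

Hypothesis g2 : two_step_solvable g.

Lemma lie_derived x y : x \in derived g -> y \in derived g -> lie x y = 0.
Proof.
move=> Ax Ay; apply/eqP; rewrite -memv0 -g2.
by have /lievP := subvv (liev (derived g) (derived g)); apply.
Qed.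

(** The defect [lie (lie x y) z] is a bracket inside the abelian derived algebra: all [ad x] commute
    there. *)
Lemma lieCA x y z : z \in derived g -> lie x (lie y z) = lie y (lie x z).
Proof.
by move=> Az; rewrite lie_leibniz (lie_derived _ Az) ?add0r ?mem_derived.
Qed.

End LieBasics.

(** * The SKT equation *)

Section SKT.
Variables (R : realFieldType) (g : lieAlgType R) (J : 'End(g)).
Variable (m : {dot g for idfun}).
Implicit Types x y z w : g.

Lemma dotDl x y z : m (x + y) z = m x z + m y z.
Proof. exact: linearDl. Qed.
Lemma dotDr x y z : m z (x + y) = m z x + m z y.
Proof. exact: linearDr. Qed.
Lemma dotNl x z : m (- x) z = - m x z.
Proof. exact: linearNl. Qed.
Lemma dotNr x z : m z (- x) = - m z x.
Proof. exact: linearNr. Qed.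
Lemma dotZl a x z : m (a *: x) z = a * m x z.
Proof. exact: linearZl_LR. Qed.
Lemma dotZr a x z : m z (a *: x) = a * m z x.
Proof. exact: (linearZr_LR (s' := idfun \; *%R)). Qed.
Lemma dot0l z : m 0 z = 0. Proof. exact: linear0l. Qed.
Lemma dot0r z : m z 0 = 0. Proof. exact: linear0r. Qed.
Lemma dotC x y : m x y = m y x.
Proof. by rewrite hermC mul1r. Qed.

Definition dotE := (dotDl, dotDr, dotNl, dotNr, dotZl, dotZr, dot0l, dot0r).

Lemma dot_ge0 x : 0 <= m x x.
Proof.
by case: (eqVneq x 0) => [->|/neq0_dnorm_gt0/ltW//]; rewrite dot0l.
Qed.

Lemma dot_eq0 x : m x x <= 0 -> x = 0.
Proof. by case: (eqVneq x 0) => // /(@neq0_dnorm_gt0 _ _ _ m); rewrite ltNge => /negP. Qed.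

Lemma dot_inj x y : (forall z, m x z = m y z) -> x = y.
Proof.
move=> e; apply/eqP; rewrite -subr_eq0; apply/eqP/dot_eq0.
by rewrite dotDl dotNl e subrr.
Qed.

(** The 3-form [d^c omega], with [J^-1 = - J] substituted. *)
Definition torsion x y z :=
  m (lie (J x) (J y)) z + m (lie (J y) (J z)) x + m (lie (J z) (J x)) y.

Hypothesis JJ : forall x, J (J x) = - x.

Lemma inv_J x : (J^-1)%VF x = - J x.
Proof.
have J0 : lker J == 0%VS.
  by apply/lker0P => u v /(congr1 J); rewrite !JJ => /oppr_inj.
by rewrite -[RHS](lker0_lfunK J0) linearN /= JJ opprK.
Qed.

(** The arguments are indexed by [nat] so that the ordinals produced by [lift] compute. *)
Lemma dc_fundamental_form (v : 'I_3 -> g) (V : nat -> g) :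
    (forall i, v i = V (val i)) ->
  dc J (fundamental_form J m) v = torsion (V 0%N) (V 1%N) (V 2%N).
Proof.
move=> vV; rewrite /dc /CE /pullback /fundamental_form /torsion.
have -> : @ord_max 1 = lift ord0 ord0 by apply: val_inj.
under eq_bigr do rewrite big_mkcond.
rewrite !big_ord_recl !big_ord0 unlift_none liftK /= !vV /= /bump /= !inv_J.
rewrite !(linearN J) /= !JJ !lieE !opprK !dotE.
rewrite (lieC (J (V 2%N))) dotNl !addn0 !add1n !exprS !expr0; ring.
Qed.

(** The six terms are those of the Chevalley-Eilenberg formula for [d] of [torsion], one per pair of
    arguments. *)
Lemma SKT_torsion x y z w : SKT J m ->
  - torsion (lie x y) z w + torsion (lie x z) y w - torsion (lie x w) y z
  - torsion (lie y z) x w + torsion (lie y w) x z - torsion (lie z w) x y = 0.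
Proof.
pose V i := nth 0 [:: x; y; z; w] i.
case=> _ /(_ (fun i => V (val i))) <-.
have dcE v : dc J (fundamental_form J m) v =
    torsion (v ord0) (v (lift ord0 ord0)) (v (lift ord0 (lift ord0 ord0))).
  rewrite (@dc_fundamental_form v (fun i => v (inord i))).
    by congr (torsion (v _) (v _) (v _)); apply: val_inj; rewrite /= inordK.
  by move=> i; rewrite inord_val.
rewrite /CE; under eq_bigr do rewrite big_mkcond.
rewrite !big_ord_recl !big_ord0 !dcE !unlift_none !liftK /= /bump /=.
by rewrite /V /= !addn0 !addSn !add0n !exprS !expr0; ring.
Qed.

End SKT.

Section SKTLie.
Variables (R : realFieldType) (g : lieAlgType R) (J : 'End(g)).
Variable (m : {dot g for idfun}).
Hypothesis g2 : two_step_solvable g.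
Hypothesis JP : complex_structure J.
Hypothesis mP : SKT J m.
Implicit Types x y z w q : g.

Local Notation A := (derived g).
Local Notation AJ := (derived g :&: J @: derived g)%VS.

Let JJ x : J (J x) = - x. Proof. exact: JP.1. Qed.
Let mJ x y : m (J x) (J y) = m x y. Proof. exact: mP.1. Qed.
Let JN x : J (- x) = - J x. Proof. exact: linearN. Qed.
Let JD x y : J (x + y) = J x + J y. Proof. exact: linearD. Qed.
Let JZ a x : J (a *: x) = a *: J x. Proof. exact: linearZ. Qed.
Let JE := (JN, JD, JZ, JJ, linear0 J).
Let A_lie x y : lie x y \in A. Proof. exact: mem_derived. Qed.

Lemma dotJl x y : m (J x) y = - m x (J y).
Proof. by rewrite -mJ JJ dotNl. Qed.

Lemma dotJx x : m x (J x) = 0.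
Proof. by have := dotJl x x; rewrite dotC; lra. Qed.

Lemma lieJJ x y : lie (J x) (J y) = lie x y + J (lie (J x) y) + J (lie x (J y)).
Proof. by apply/eqP; rewrite eq_sym -subr_eq0 JP.2. Qed.

Lemma mem_derivedJ x : (x \in AJ) = (x \in A) && (J x \in A).
Proof.
rewrite memv_cap; congr (_ && _); apply/memv_imgP/idP => [[y Ay ->]|AJx].
  by rewrite JJ memvN.
by exists (- J x); rewrite ?memvN // linearN /= JJ opprK.
Qed.

Lemma J_derivedJ x : x \in AJ -> J x \in AJ.
Proof. by rewrite !mem_derivedJ JJ memvN andbC. Qed.

(** In the integrability equation the brackets of [z] with [q] and [J q] vanish, [A] being abelian.
    So [ad (J z)] is complex linear on [AJ]. *)
Lemma lieJ_derivedJ z q : z \in A -> q \in AJ ->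
  lie (J z) (J q) = J (lie (J z) q).
Proof.
rewrite mem_derivedJ => Az /andP[Aq AJq].
by rewrite lieJJ !(lie_derived g2 Az) // linear0 add0r addr0.
Qed.

Lemma lie_mem_derivedJ z q : z \in A -> q \in AJ -> lie (J z) q \in AJ.
Proof. by move=> Az Aq; rewrite mem_derivedJ -lieJ_derivedJ // !A_lie. Qed.

(* Hence [A / AJ] is a commutative algebra for the product [z w := lie (J z) w];
   it is associative because [ad g] acts on [A] by commuting operators. *)
Lemma lieJ_sym z w : z \in A -> w \in A -> lie (J z) w - lie (J w) z \in AJ.
Proof.
move=> Az Aw; rewrite mem_derivedJ memvB ?A_lie //=.
have <- : lie (J z) (J w) = J (lie (J z) w - lie (J w) z); last exact: A_lie.
by rewrite lieJJ (lie_derived g2 Az Aw) add0r (lieC z) linearN linearB.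
Qed.

(** The SKT equation at [(z, J z, q, J q)]: brackets inside [A] vanish, and complex linearity of
    [ad (J z)] on [AJ] merges the remaining terms. *)
Lemma SKT_derivedJ z q : z \in A -> q \in AJ ->
  m (lie (J (lie (J z) z)) q) q + m (lie (J z) (lie (J z) q)) q
    + m (lie (J z) q) (lie (J z) q) = 0.
Proof.
move=> Az AJq.
(* Brackets get opaque names, so that the rewrites below reach only the outer ones. *)
have [s Ds] : {s | lie (J z) z = s} by eexists.
have [e De] : {e | lie (J z) q = e} by eexists.
have [ee Dee] : {ee | lie (J z) e = ee} by eexists.
have [e2 De2] : {e2 | lie (J s) q = e2} by eexists.
have As : s \in A by rewrite -Ds.
have AJe : e \in AJ by rewrite -De lie_mem_derivedJ.
have [/andP[Aq Aq'] /andP[Ae Ae']] :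
    (q \in A) && (J q \in A) /\ (e \in A) && (J e \in A) by rewrite -!mem_derivedJ.
have := SKT_torsion JJ z (J z) q (J q) mP.
rewrite (lieC z) Ds De (lieJ_derivedJ Az AJq) De (lie_derived g2 Az Aq).
rewrite (lie_derived g2 Az Aq') (lie_derived g2 Aq Aq') /torsion Dee De2.
rewrite !JE !lieE !dotE.
rewrite (lieJ_derivedJ As AJq) (lieC q) De2 (lie_derived g2 Aq' Aq).
rewrite (lieC (J e)) (lieJ_derivedJ Az AJe) Dee.
rewrite (lie_derived g2 Aq Ae') (lieC e) Dee De (lieJ_derivedJ Az AJq) De.
rewrite (lie_derived g2 Aq' Ae) !dotE !mJ => h.
lra.
Qed.

(** A Rayleigh quotient: linear in [y] for every [x], and the eigenvalue when [x] is a nonzero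
    eigenvector of [ad y]. *)
Definition weight x y : R := m (lie y x) x / m x x.
Definition eigenvector x : Prop := forall y, lie y x = weight x y *: x.

Lemma weightD x y z : weight x (y + z) = weight x y + weight x z.
Proof. by rewrite /weight lieDl dotDl mulrDl. Qed.
Lemma weightN x y : weight x (- y) = - weight x y.
Proof. by rewrite /weight lieNl dotNl mulNr. Qed.
Lemma weightZ x a y : weight x (a *: y) = a * weight x y.
Proof. by rewrite /weight lieZl dotZl mulrA. Qed.

Lemma dot_neq0 x : x != 0 -> m x x != 0.
Proof. by move=> nx; rewrite gt_eqF // neq0_dnorm_gt0. Qed.

Lemma weightE x y a : x != 0 -> lie y x = a *: x -> weight x y = a.
Proof. by move=> nx e; rewrite /weight e dotZl mulfK ?dot_neq0. Qed.

Lemma weight_derived x y : x \in A -> y \in A -> weight x y = 0.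
Proof. by move=> Ax Ay; rewrite /weight lie_derived // dot0l mul0r. Qed.

(** The SKT equation at [(x, J x, y, J y)]. Integrability gives [[J y, J x]] and commutation on [A]
    gives [[J y, v]], after which [u = [y, J v]] cancels. The left-hand side is a sum of squares. *)
Lemma SKT_eigenvector_derivedJ x y : x \in AJ -> eigenvector x ->
  (weight x y ^+ 2 + weight x (J y) ^+ 2) * m x x
    + m (lie y (J x) + weight x (J y) *: x) (lie y (J x) + weight x (J y) *: x)
  = weight x (J (lie y (J y))) * m x x.
Proof.
move=> AJx xP.
have /andP[Ax AJx'] : (x \in A) && (J x \in A) by rewrite -mem_derivedJ.
have [a Da] : {a | weight x y = a} by eexists.
have [b Db] : {b | weight x (J y) = b} by eexists.
have [w Dw] : {w | lie y (J y) = w} by eexists.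
have [c Dc] : {c | weight x (J w) = c} by eexists.
have [v Dv] : {v | lie y (J x) = v} by eexists.
have [u Du] : {u | lie y (J v) = u} by eexists.
have Aw : w \in A by rewrite -Dw.
have Av : v \in A by rewrite -Dv.
have yx : lie y x = a *: x by rewrite xP Da.
have Jyx : lie (J y) x = b *: x by rewrite xP Db.
have Jwx : lie (J w) x = c *: x by rewrite xP Dc.
have JyJx : lie (J y) (J x) = a *: x + b *: J x + J v.
  by rewrite lieJJ yx Jyx Dv linearZ.
have JwJx : lie (J w) (J x) = c *: J x by rewrite (lieJ_derivedJ Aw AJx) Jwx linearZ.
have AJv : J v \in A.
  rewrite -[J v](addKr (a *: x + b *: J x)) -JyJx addrC memvB ?A_lie //.
  by rewrite memvD ?memvZ.
have Jyv : lie (J y) v = u + a ^+ 2 *: x + b *: v.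
  rewrite -Dv (lieCA g2) // JyJx !lieE yx Dv Du scalerA -expr2.
  by rewrite addrC addrA.
have := SKT_torsion JJ x (J x) y (J y) mP.
rewrite (lie_derived g2 Ax AJx') (lieC x y) yx (lieC x (J y)) Jyx (lieC (J x) y) Dv.
rewrite (lieC (J x) (J y)) JyJx Dw /torsion Dc Da Db.
rewrite !JE !lieE !dotE.
have [[Jxx xJx] JvJx vJx] : [/\ lie (J x) x = 0 /\ lie x (J x) = 0,
  lie (J v) (J x) = 0 & lie v (J x) = 0] by rewrite !(lie_derived g2).
rewrite Jxx xJx JvJx vJx liexx (lieC x y) yx (lieC x (J y)) Jyx (lieC (J x) y) Dv.
rewrite (lieC (J x) (J y)) JyJx (lieC x (J w)) Jwx JwJx Du Jyv !dotE !mJ => h.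
move: h; rewrite (dotC _ x (J v)) (dotC _ (J x) x) (dotJl v x) (dotC _ v x) dotJx; lra.
Qed.

(* Here [p] automatically lies in [AJ], by [lieJ_eigenvector]. *)
Lemma SKT_eigenvector x y (p := lie (J x) y - weight x (J y) *: x) :
    x \in A -> eigenvector x -> weight x (J x) = 0 ->
    lie (J x) p = 0 -> lie (J x) (J p) = 0 ->
  (weight x y ^+ 2 + weight x (J y) ^+ 2) * m x x + m p p
    + m (lie (J x) (lie y (J y))) x
  = weight x (J (lie y (J y))) * m x x.
Proof.
move=> Ax xP; rewrite {}/p.
have [a Da] : {a | weight x y = a} by eexists.
have [b Db] : {b | weight x (J y) = b} by eexists.
have [w Dw] : {w | lie y (J y) = w} by eexists.
have [c Dc] : {c | weight x (J w) = c} by eexists.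
have [p Dp] : {p | lie (J x) y - b *: x = p} by eexists.
have [u Du] : {u | lie y (J p) = u} by eexists.
have [k Dk] : {k | lie (J x) w = k} by eexists.
rewrite Db Dp Da Dw Dc Dk => e0 xp xJp.
have Jxx : lie (J x) x = 0 by rewrite xP e0 scale0r.
have Aw : w \in A by rewrite -Dw.
have yx : lie y x = a *: x by rewrite xP Da.
have Jyx : lie (J y) x = b *: x by rewrite xP Db.
have Jwx : lie (J w) x = c *: x by rewrite xP Dc.
have wx : lie w x = 0 by rewrite (lie_derived g2).
have Jxy : lie (J x) y = p + b *: x by rewrite -Dp subrK.
have JxJ z : lie (J x) (J z) = J (lie (J x) z) - weight x z *: x
    - weight x (J z) *: J x.
  rewrite lieJJ (lieC x z) (lieC x (J z)) !xP JN JZ.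
  by apply: (dot_inj (m := m)) => v; rewrite !(JE, dotE); ring.
have JxJy : lie (J x) (J y) = J p - a *: x.
  by apply: (dot_inj (m := m)) => v; rewrite JxJ Jxy Da Db !(JE, dotE); ring.
have JxJw : lie (J x) (J w) = J k - c *: J x.
  by rewrite JxJ Dk Dc (weight_derived Ax Aw) scale0r subr0.
(* The derivation [ad (J x)] applied to [[y, J y] = w] yields [[J y, p]], which makes [u] cancel in
   the SKT equation. *)
have Jyp : lie (J y) p = u - k - (a ^+ 2 + b ^+ 2) *: x.
  apply: (dot_inj (m := m)) => z; have := lie_leibniz (J x) y (J y).
  rewrite Dw Dk Jxy JxJy => ->; rewrite (lieC _ (J y)) !lieE Du yx Jyx !dotE; ring.
have := SKT_torsion JJ x (J x) y (J y) mP.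
rewrite (lieC x (J x)) Jxx (lieC x y) yx (lieC x (J y)) Jyx Jxy JxJy Dw.
rewrite /torsion !(JE, lieE, dotE, opprK).
rewrite (lieC x y) yx (lieC x (J y)) Jyx (lieC (J p)) xJp (lieC p) xp.
rewrite (lieC y (J x)) Jxy (lieC (J y) (J x)) JxJy (lieC (J w)) JxJw liexx.
rewrite (lieC x (J w)) Jwx Du Jyp !(JE, dotE, mJ) => h.
move: h; rewrite Jxx !dot0l dotJx (dotC _ x p) (dotC _ x (J p)).
rewrite (dotJl p x); lra.
Qed.

Hypothesis eigP : forall y, has_eigenvectors (ad y).

Lemma SKT_derivedJ_eigenvalue z q a b : z \in A -> q \in AJ -> q != 0 ->
  lie (J z) q = a *: q -> lie (J (lie (J z) z)) q = b *: q -> b = - 2 * a ^+ 2.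
Proof.
move=> Az AJq nq za zb; have := SKT_derivedJ Az AJq; rewrite zb za lieZr za !dotE.
by move=> h; apply: (mulIf (dot_neq0 nq)); lra.
Qed.

(** An eigenvector would give [a = b = 1] in [b = - 2 a^2]. *)
Lemma derivedJ_fixed z q : z \in A -> lie (J z) z = z -> q \in AJ ->
  lie (J z) q = q -> q = 0.
Proof.
move=> Az zz AJq zq; apply/eqP; apply: contraT => nq.
have := @SKT_derivedJ_eigenvalue z q 1 1 Az AJq nq; rewrite zz zq scale1r.
by move=> /(_ erefl erefl); lra.
Qed.

Lemma lieJ_derivedJ_comm z w q : z \in A -> w \in A -> q \in A ->
  lie (J (lie (J z) w)) q = lie (J (lie (J w) z)) q.
Proof.
move=> Az Aw Aq; have := lieJ_sym Az Aw; rewrite mem_derivedJ => /andP[_].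
by move=> /(lie_derived g2)/(_ Aq)/eqP; rewrite linearB lieBl subr_eq0 => /eqP.
Qed.


(** With [b = 0] all eigenvalues of [D = ad (J x)] on [AJ] are zero, so [D] is nilpotent there; if
    [D (D q) = 0], then [SKT_derivedJ] reduces to [|D q|^2 = 0]. *)
Lemma derivedJ_centralised x : x \in A -> lie (J x) x = 0 ->
  {in AJ, forall q, lie (J x) q = 0}.
Proof.
move=> Ax xx.
have [|a q AJq nq /= xq|N xN q AJq] := nilpotent_of_eigenvalues (@eigP (J x)) (S := AJ).
- by apply/subvP => _ /memv_imgP[q AJq ->]; rewrite adE lie_mem_derivedJ.
- have := @SKT_derivedJ_eigenvalue x q a 0 Ax AJq nq.
  rewrite -adE xq xx linear0 lie0l scale0r => /(_ erefl erefl) h; apply/eqP.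
  by rewrite -sqrf_eq0; apply/eqP; lra.
have := xN q AJq; elim: N q AJq {xN} => [|[|N] IH] q AJq.
- by move=> /= ->; rewrite lie0r.
- by rewrite /= adE.
rewrite iterSr => /IH; rewrite adE lie_mem_derivedJ // => /(_ isT) xxq.
have := SKT_derivedJ Ax AJq; rewrite xx linear0 lie0l xxq !dot0l !add0r => h.
by apply: (dot_eq0 (m := m)); rewrite h.
Qed.

(** Eigenspaces are cut out for one basis vector of [H] at a time; each is stable under [H] because
    the operators commute on [A]. *)
Lemma joint_eigenvector (H S : {vspace g}) : S != 0%VS -> (S <= A)%VS ->
    (forall y v, y \in H -> v \in S -> lie y v \in S) ->
  exists x, [/\ x \in S, x != 0 & {in H, forall y, lie y x = weight x y *: x}].
Proof.
move=> nS SA HS.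
have scalar_on (l : seq g) : {subset l <= H} -> exists T : {vspace g},
    [/\ T != 0%VS, (T <= S)%VS,
        forall y v, y \in H -> v \in T -> lie y v \in T &
        {in l, forall y, exists a, {in T, forall v, lie y v = a *: v}}].
  elim: l => [|y l IH] lH; first by exists S; split.
  have [z lz|T [nT TS HT lT]] := IH; first by apply: lH; rewrite inE lz orbT.
  have Hy : y \in H by apply: lH; rewrite mem_head.
  have [|a [v [Tv nv yv]]] := @eigP y _ nT.
    by apply/subvP => _ /memv_imgP[v Tv ->]; rewrite adE HT.
  exists (T :&: lker (ad y - a *: \1%VF))%VS.
  have memP u : (u \in (T :&: lker (ad y - a *: \1%VF))%VS) =
      (u \in T) && (lie y u == a *: u).
    by rewrite memv_cap memv_ker add_lfunE opp_lfunE scale_lfunE id_lfunE adE subr_eq0.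
  split=> [|||z]; first 1 last.
  - exact: subv_trans (capvSl _ _) TS.
  - move=> z u Hz; rewrite !memP => /andP[Tu /eqP yu]; rewrite HT //=.
    have Au : u \in A by apply: (subvP SA); apply: (subvP TS).
    by rewrite (lieCA g2) // yu lieZr.
  - rewrite inE => /predU1P[->|/lT[b zb]].
      by exists a => u; rewrite memP => /andP[_ /eqP].
    by exists b => u; rewrite memP => /andP[/zb].
  apply/eqP => T0; have : v \in (T :&: lker (ad y - a *: \1%VF))%VS.
    by rewrite memP Tv -adE yv eqxx.
  by rewrite T0 memv0 (negPf nv).
have [y|T [nT TS _ HT]] := scalar_on (vbasis H); first exact: vbasis_mem.
exists (vpick T); have nx : vpick T != 0 by rewrite vpick0.
split=> // [|y Hy]; first by rewrite (subvP TS) ?memv_pick.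
suff [a ya] : exists a, lie y (vpick T) = a *: vpick T by rewrite (weightE nx ya).
rewrite (coord_vbasis Hy) lie_suml.
have HTi i : exists a, lie (vbasis H)`_i (vpick T) = a *: vpick T.
  case: (ltnP i (size (vbasis H))) => [lt|ge]; last first.
    by exists 0; rewrite nth_default // lie0l scale0r.
  by have [a aP] := HT _ (mem_nth 0 lt); exists a; rewrite aP ?memv_pick.
elim/big_rec: _ => [|i u _ [b ub]]; first by exists 0; rewrite scale0r.
have [a ia] := HTi i;
exists (coord (vbasis H) i y * a + b).
by rewrite lieZl ia ub scalerA scalerDl.
Qed.


(** * Affine families and characters *)

Lemma scale_memN (k : R) x : k *: x \in AJ -> x \notin AJ -> k = 0.
Proof.
move=> AJkx; apply: contraNeq => nk.
by rewrite -[x](scalerK nk) memvZ.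
Qed.

Lemma idempotent_notin x : x \in A -> x != 0 -> lie (J x) x = x -> x \notin AJ.
Proof.
rewrite mem_derivedJ => Ax nx xx; rewrite Ax /=; apply: contraNN nx => AJx.
by rewrite -xx (lie_derived g2).
Qed.

(** Weaker than [eigenvector]: inside [AJ], joint eigenvectors are found for the operators
    [ad (J z)] with [z] in [A], which preserve [AJ]. *)
Definition J_eigenvector x := {in A, forall z, lie (J z) x = weight x (J z) *: x}.

(* The characters of the algebra [A / AJ]. *)
Definition character (s : g -> R) :=
  (forall k x y, s (k *: x + y) = k * s x + s y) /\
  {in A &, forall x y, s (lie (J x) y) = s x * s y}.

Lemma weight_linear x k y z : weight x (k *: y + z) = k * weight x y + weight x z.
Proof. by rewrite weightD weightZ. Qed.

(** Modulo [AJ] the product [x z] is [weight x (J z) *: x], so associativity compares two multiples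
    of [x], which is nonzero there. *)
Lemma character_weight x : x \in A -> x \notin AJ -> J_eigenvector x ->
  character (fun z => weight x (J z)).
Proof.
move=> Ax AJx xP; split=> [k y z|z w Az Aw]; first by rewrite JD JZ weight_linear.
apply/eqP; rewrite -subr_eq0; apply/eqP; apply: (scale_memN _ AJx).
have xE v : v \in A -> weight x (J v) *: x - lie (J x) v \in AJ.
  by move=> Av; rewrite -xP // lieJ_sym.
rewrite scalerBl.
have -> : (weight x (J z) * weight x (J w)) *: x =
    lie (J x) (lie (J z) w) + lie (J z) (weight x (J w) *: x - lie (J x) w).
  rewrite lieBr lieZr (lieCA g2 (J z)) // xP // scalerA mulrC.
  by rewrite addrCA subrr addr0.
by rewrite opprD addrA memvB ?xE ?A_lie // lie_mem_derivedJ ?xE.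
Qed.

(** The relation [b = - 2 a^2] says that [- 2 * weight x (J z)] respects squares; polarisation gives
    products. *)
Lemma character_weight_derivedJ x : x \in AJ -> x != 0 -> J_eigenvector x ->
  character (fun z => - 2 * weight x (J z)).
Proof.
move=> AJx nx xP; split=> [k y z|z w Az Aw]; first by rewrite JD JZ weight_linear; ring.
have Ax : x \in A by move: AJx; rewrite mem_derivedJ => /andP[].
have sq v : v \in A -> weight x (J (lie (J v) v)) = - 2 * weight x (J v) ^+ 2.
  by move=> Av; apply: (SKT_derivedJ_eigenvalue Av AJx nx); rewrite xP.
have := sq _ (memvD Az Aw); rewrite !(JE, lieE, weightD) sq // sq //.
have -> : weight x (J (lie (J w) z)) = weight x (J (lie (J z) w)).
  by apply: weightE => //; rewrite lieJ_derivedJ_comm // xP.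
lra.
Qed.

Definition aff_family (s : seq g) :=
  [/\ uniq s,
      {in s, forall x, [/\ x \in A, x != 0, eigenvector x & lie (J x) x = x]} &
      {in s &, forall x y, x != y -> lie (J x) y = 0}].

Definition maximal_family s := aff_family s /\ forall x, ~ aff_family (x :: s).

Lemma eigenvectorZ k x : k != 0 -> eigenvector x -> eigenvector (k *: x).
Proof.
move=> nk xP y; case: (eqVneq x 0) => [->|nx]; first by rewrite !scaler0 lie0r.
have e : lie y (k *: x) = weight x y *: (k *: x) by rewrite lieZr xP !scalerA mulrC.
by rewrite (weightE _ e) // scaler_eq0 negb_or nk.
Qed.

Lemma eigenvector_J x : eigenvector x -> J_eigenvector x.
Proof. by move=> xP z _; exact: xP. Qed.

Lemma eigenvector_sym x y : x \in A -> y \in A -> eigenvector x -> eigenvector y ->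
  weight x (J y) *: x - weight y (J x) *: y \in AJ.
Proof. by move=> Ax Ay xP yP; rewrite -xP -yP lieJ_sym. Qed.

(* If [chi w = 1], the square [z] of [w] has a joint eigenvector [x] in [A] with
   [lie (J z) x = x]; squaring makes all eigenvalues of [ad (J z)] on [AJ] at
   most [0], so [x] is not in [AJ]. If [weight x (J x) <> 0], a multiple of [x] extends
   the family; otherwise [SKT_eigenvector] fails for the generalised eigencomponent
   [z1] of [z]. *)
Lemma maximal_character s (chi : g -> R) w : maximal_family s -> character chi ->
  w \in A -> {in s, forall x, weight x (J w) = 0} -> chi w = 0.
Proof.
case=> -[us sP sO] smax [chiL chiM] Aw sw.
have chiB x y : chi (x - y) = chi x - chi y.
  by rewrite addrC -scaleN1r chiL mulN1r addrC.
have chi0 : chi 0 = 0 by rewrite -(subrr w) chiB subrr.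
apply/eqP; apply: contraT => nw; wlog w1 : w Aw sw nw / chi w = 1.
  move=> /(_ ((chi w)^-1 *: w)); rewrite memvZ //.
  have -> : chi ((chi w)^-1 *: w) = 1 by rewrite -[_ *: w]addr0 chiL chi0 addr0 mulVf.
  by rewrite oner_neq0; apply=> // x sx; rewrite JZ weightZ sw // mulr0.
set z := lie (J w) w; have Az : z \in A by apply: A_lie.
have chiz : chi z = 1 by rewrite chiM // w1 mulr1.
have notin x : x \in s -> x \notin AJ.
  by case/sP=> Ax nx _ xx; apply: idempotent_notin.
have sz x : x \in s -> weight x (J z) = 0.
  move=> sx; have [Ax nx xP xx] := sP x sx.
  have [_ ->//] := character_weight Ax (notin x sx) (eigenvector_J xP).
  by rewrite sw // mul0r.
pose T := (ad (J z) - \1%VF)%R; have TE x : T x = lie (J z) x - x.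
  by rewrite /T add_lfunE opp_lfunE id_lfunE adE.
have T_AJ q : q \in AJ -> lie (J z) q = q -> q = 0.
  move=> AJq zq; apply/eqP; apply: contraT => nq.
  have Aq : q \in A by move: AJq; rewrite mem_derivedJ => /andP[].
  pose S := (AJ :&: lker T)%VS.
  have SE v : (v \in S) = (v \in AJ) && (lie (J z) v == v).
    by rewrite /S memv_cap memv_ker TE subr_eq0.
  have SA v : v \in AJ -> v \in A by rewrite mem_derivedJ => /andP[].
  have [||a [v []]] := @eigP (J w) S.
  - by apply: contra_neq nq => S0; apply/eqP; rewrite -memv0 -S0 SE AJq zq /=.
  - apply/subvP => _ /memv_imgP[v + ->]; rewrite adE !SE => /andP[AJv /eqP zv].
    by rewrite lie_mem_derivedJ //= (lieCA g2) ?zv ?SA.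
  rewrite SE adE => /andP[AJv /eqP zv] nv wv.
  have := @SKT_derivedJ_eigenvalue w v a 1 Aw AJv nv wv; rewrite scale1r.
  by move=> /(_ zv); have := sqr_ge0 a; lra.
pose S := (A :&: lker T)%VS.
have SE v : (v \in S) = (v \in A) && (lie (J z) v == v).
  by rewrite /S memv_cap memv_ker TE subr_eq0.
have TA : (T @: A <= A)%VS.
  by apply/subvP => _ /memv_imgP[v Av ->]; rewrite TE memvB.
(* If [T] were injective on [A], then [z = T a] with [a] in [A], and
   [chi z = chi z * chi a - chi a = 0]. *)
have nS : S != 0%VS.
  apply/eqP => S0; have := limg_dim_eq S0 => /eqP; rewrite (dimv_leqif_eq TA).2.
  move=> /eqP TAA; have : z \in (T @: A)%VS by rewrite TAA.
  case/memv_imgP => a Aa; rewrite TE => za; have := chiz; rewrite za chiB chiM //.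
  by rewrite chiz mul1r subrr => /eqP; rewrite eq_sym oner_eq0.
have [||x [+ nx xP]] := @joint_eigenvector fullv S nS.
- exact: capvSl.
- move=> y v _; rewrite !SE => /andP[Av /eqP zv].
  by rewrite A_lie /= (lieCA g2) // zv.
rewrite SE => /andP[Ax /eqP zx]; have {}xP : eigenvector x by move=> y; apply: xP (memvf _).
have AJx : x \notin AJ by apply: contraNN nx => AJx; rewrite (T_AJ x).
have wz : weight x (J z) = 1 by apply: weightE; rewrite ?scale1r.
case: (eqVneq (weight x (J x)) 0) => [x0|nx0]; last first.
  set y := (weight x (J x))^-1 *: x.
  have nk : (weight x (J x))^-1 != 0 by rewrite invr_eq0.
  have ny : y != 0 by rewrite scaler_eq0 negb_or nk.
  have Ay : y \in A by rewrite memvZ.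
  have yP : eigenvector y by apply: eigenvectorZ.
  have zy : lie (J z) y = y by rewrite lieZr zx.
  have yy : lie (J y) y = y.
    by rewrite JZ lieZl lieZr xP !scalerA -mulrA mulVf // mulr1.
  clearbody y; have AJy := idempotent_notin Ay ny yy.
  have sy v : v \in s -> lie (J v) y = 0 /\ lie (J y) v = 0.
    move=> sv; have [Av nv vP _] := sP v sv; rewrite yP vP.
    have := eigenvector_sym Ay Av yP vP => h.
    (* [ad (J z)] fixes [y] and kills [v], so it isolates the [y] term of the relation [h] modulo
       [AJ]. *)
    have yv0 : weight y (J v) = 0.
      apply: (scale_memN _ AJy); have := lie_mem_derivedJ Az h.
      by rewrite lieBr !lieZr zy vP sz // scale0r scaler0 subr0.
    move: h; rewrite yv0 scale0r sub0r memvN => /scale_memN/(_ (notin v sv)) ->.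
    by rewrite scale0r.
  case: (smax y); split=> [|v|u v].
  - rewrite /= us andbT; apply: contraNN ny => /sz y0.
    by rewrite -zy yP y0 scale0r.
  - by rewrite inE => /predU1P[->|/sP].
  - rewrite !inE => /predU1P[->|su] /predU1P[->|sv] //; first by rewrite eqxx.
    + by move=> _; case: (sy v sv).
    + by move=> _; case: (sy u su).
    + exact: sO.
have xx : lie (J x) x = 0 by rewrite xP x0 scale0r.
have [_ /= chixM] := character_weight Ax AJx (eigenvector_J xP).
(* [z1] is the part of [z] in the generalised kernel of [T]; the character of [x] is 0 on [T b],
   hence still 1 on [z1]. *)
have [N /(_ z Az)[b Ab Nb]] := fitting TA.
set z1 := z - T b in Nb.
have AT v : v \in A -> T v \in A by move=> Av; apply: (subvP TA); apply: memv_img.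
have Az1 : z1 \in A by rewrite memvB ?AT.
have wz1 : weight x (J z1) = 1.
  have /= := chixM z b Az Ab; rewrite wz mul1r => zb.
  by rewrite /z1 TE !(JD, JN, weightD, weightN) zb subrr subr0.
clearbody z1; have DT v : v \in A -> lie (J x) (T v) = T (lie (J x) v).
  by move=> Av; rewrite !TE lieBr (lieCA g2).
(* The difference lies in [AJ] and is killed by a power of [T], which is injective on [AJ]. *)
have xz1 : lie (J x) z1 = x.
  apply/eqP; rewrite -subr_eq0; apply/eqP.
  have : lie (J x) z1 - x \in AJ.
    by have := lieJ_sym Ax Az1; rewrite (xP (J z1)) wz1 scale1r.
  have : iter N T (lie (J x) z1 - x) = 0.
    case: N Nb => [z10|N].
      by move: wz1; rewrite [z1]z10 linear0 /weight lie0l dot0l mul0r => /eqP;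
         rewrite eq_sym oner_eq0.
    rewrite !iterSr linearB /= [T x]TE zx subrr subr0 -DT //.
    elim: N (T z1) (AT _ Az1) => [|N IH] v Av.
      by rewrite /= => ->; rewrite lie0r.
    by rewrite !iterSr -DT // => /IH; apply; apply: AT.
  elim: N {Nb} (lie _ _ - x) => [//|N IH] q; rewrite iterSr => TN AJq.
  apply: T_AJ => //; apply/eqP; rewrite -subr_eq0 -TE; apply/eqP/IH => //.
  by rewrite TE memvB // lie_mem_derivedJ.
(* Here [p = 0], and the equation becomes [|x|^2 - |x|^2 = - |x|^2]. *)
have := @SKT_eigenvector x z1 Ax xP x0.
have AJ0 q : q \in AJ -> lie (J x) q = 0 by apply: derivedJ_centralised.
rewrite wz1 scale1r xz1 subrr !(JE, lie0r) => /(_ erefl erefl).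
rewrite (lieC z1) JN weightN chixM // wz1 lieNr (lieCA g2) // xz1.
rewrite xP wz1 scale1r !dotE weight_derived // => h.
by case/negP: nx; apply/eqP/(@dot_eq0 _ _ m); lra.
Qed.

(** For arbitrary [z], integrability turns [J] of the difference into
    [lie (J x) (J z) + weight x z *: x], an element of [A]. *)
Lemma lieJ_eigenvector x z : x \in A -> eigenvector x ->
  lie (J x) z - weight x (J z) *: x \in AJ.
Proof.
move=> Ax xP; rewrite mem_derivedJ memvB ?memvZ ?A_lie //=.
have -> : J (lie (J x) z - weight x (J z) *: x) =
    lie (J x) (J z) + weight x z *: x.
  apply: (dot_inj (m := m)) => v; rewrite lieJJ (lieC x z) (lieC x (J z)) !xP.
  by rewrite !(JE, dotE); ring.
by rewrite memvD ?memvZ.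
Qed.

(** * The centraliser of a maximal family *)

(* Modulo the image of [ad (J x) - 1] on [A], a complement of [x] that contains
   [AJ] and is stable under [ad g], the operator [ad (J x)] is rank one. *)
Lemma weightJ_lie x y z : x \in A -> x != 0 -> eigenvector x -> lie (J x) x = x ->
  weight x (J (lie z y)) =
  weight x z * weight x (J y) - weight x (J z) * weight x y.
Proof.
move=> Ax nx xP xx; pose T := (ad (J x) - \1%VF)%R.
have TE v : T v = lie (J x) v - v by rewrite /T add_lfunE opp_lfunE id_lfunE adE.
pose C := (T @: A)%VS.
have C_lie v u : u \in C -> lie v u \in C.
  case/memv_imgP=> a Aa ->; rewrite TE lieBr (lieCA g2) // -TE memv_img //.
have AJx := idempotent_notin Ax nx xx.
have TAJ : (T @: AJ <= AJ)%VS.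
  by apply/subvP => _ /memv_imgP[q AJq ->]; rewrite TE memvB // lie_mem_derivedJ.
have AJC q : q \in AJ -> q \in C.
  suff : (T @: AJ)%VS = AJ by move=> <-; apply: (subvP (limgS _ (capvSl _ _))).
  apply/eqP; rewrite -(dimv_leqif_eq TAJ).2 limg_dim_eq //.
  apply/eqP; rewrite -subv0; apply/subvP => v.
  rewrite memv_cap memv_ker TE subr_eq0 memv0 => /andP[AJv /eqP xv].
  by rewrite (derivedJ_fixed Ax xx AJv xv).
(* If [x = T a], then [a] is a multiple of [x] modulo [AJ]; as [T x = 0], this puts [x] in [AJ]. *)
have xC : x \notin C.
  apply: contraNN AJx => /memv_imgP[a Aa]; rewrite TE => xa.
  pose k := weight x (J a).
  have AJq : k *: x - lie (J x) a \in AJ by rewrite -xP lieJ_sym.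
  have ka : a = (k - 1) *: x - (k *: x - lie (J x) a).
    by rewrite scalerBl scale1r {2}xa; apply: (dot_inj (m := m)) => v; rewrite !dotE; ring.
  have AJTq : T (k *: x - lie (J x) a) \in AJ by apply: (subvP TAJ); apply: memv_img.
  rewrite xa -TE ka linearB linearZ /= [T x]TE xx subrr scaler0 sub0r memvN //.
have C0 k : k *: x \in C -> k = 0.
  by move=> kC; apply: contraNeq xC => nk; rewrite -[x](scalerK nk) memvZ.
apply/eqP; rewrite -subr_eq0; apply/eqP/C0.
have [pz Dz] : {p | lie (J x) z - weight x (J z) *: x = p} by eexists.
have [py Dy] : {p | lie (J x) y - weight x (J y) *: x = p} by eexists.
have AJz : pz \in C by rewrite -Dz AJC // lieJ_eigenvector.
have AJy : py \in C by rewrite -Dy AJC // lieJ_eigenvector.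
have -> : (weight x (J (lie z y)) - (weight x z * weight x (J y) -
    weight x (J z) * weight x y)) *: x =
  (weight x (J (lie z y)) *: x - lie (J x) (lie z y)) + (lie z py - lie y pz).
  rewrite lie_leibniz (lieC (lie (J x) z)) -Dy -Dz.
  by apply: (dot_inj (m := m)) => v; rewrite !(lieE, xP, dotE); ring.
by apply: memvD; [apply: AJC; rewrite -xP lieJ_sym|rewrite memvB ?C_lie].
Qed.

Lemma weight_sum x s (c : g -> R) : J_eigenvector x ->
  weight x (J (\sum_(u <- s) c u *: u)) = \sum_(u <- s) c u * weight x (J u).
Proof.
move=> xP; elim: s => [|u s IH].
  by rewrite !big_nil linear0 /weight lie0l dot0l mul0r.
by rewrite !big_cons JD JZ weight_linear IH.
Qed.

Lemma aff_family_split s z : aff_family s -> z \in A ->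
  exists2 v, v \in A & {in s, forall u, weight u (J v) = 0} /\
    z = v + \sum_(u <- s) weight u (J z) *: u.
Proof.
case=> us sP sO Az; set t := \sum_(u <- s) _.
have At : t \in A.
  rewrite /t big_seq; apply: memv_suml => u su; rewrite memvZ //.
  by case: (sP u su).
exists (z - t); rewrite ?memvB // subrK; split=> // u su.
have [Au nu uP uu] := sP u su.
rewrite JD JN weightD weightN /t weight_sum; last exact: eigenvector_J.
have u1 : weight u (J u) = 1 by apply: weightE; rewrite ?scale1r.
rewrite (bigD1_seq u) //= u1 mulr1.
rewrite big_seq_cond big1 ?addr0 ?subrr // => v /andP[sv nvu].
by rewrite [weight u _](weightE (a := 0) nu) ?mulr0 // scale0r sO.
Qed.

Lemma sqr_weight0 x y : x != 0 ->
  (weight x y ^+ 2 + weight x (J y) ^+ 2) * m x x <= 0 -> weight x y = 0.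
Proof.
move=> nx; rewrite pmulr_lle0 ?neq0_dnorm_gt0 // => h; apply/eqP.
rewrite -sqrf_eq0; apply/eqP; apply: le_anti; rewrite sqr_ge0 andbT.
by apply: le_trans h; rewrite lerDl sqr_ge0.
Qed.

(* [D := ad (J x)] maps [A] to [AJ] and kills [AJ], and [SKT_eigenvector] becomes
   |D v|^2 = <D [J v, v], x>. For the powers [v := (ad (J z))^j z] the right-hand
   side is <(ad (J z))^(2j+1) (D z), x>, which vanishes for large [j]; descending
   on [j] gives [D z = 0]. *)
Lemma derived_centralised s x : maximal_family s -> x \in A -> x \notin AJ ->
    eigenvector x -> {in A, forall z, weight x (J z) = 0} ->
  {in A, forall z, lie (J x) z = 0}.
Proof.
move=> smax Ax AJx xP x0; have [[us sP sO] _] := smax.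
pose D := lie (J x).
have xx : D x = 0 by rewrite /D xP x0 // scale0r.
have DAJ v : v \in A -> D v \in AJ.
  move=> Av; have := lieJ_eigenvector v Ax xP.
  by rewrite x0 // scale0r subr0.
have D0 q : q \in AJ -> D q = 0 by apply: derivedJ_centralised.
have Du u : u \in s -> D u = 0.
  move=> su; have [Au nu uP uu] := sP u su.
  have := DAJ _ Au; rewrite /D uP => /scale_memN -> ; rewrite ?scale0r //.
  exact: idempotent_notin.
have Dsq v : v \in A -> m (D v) (D v) = m (D (lie (J v) v)) x.
  move=> Av; have := @SKT_eigenvector x v Ax xP (x0 _ Ax).
  rewrite (weight_derived Ax Av) (x0 _ Av) (x0 _ (A_lie _ _)) scale0r subr0 -/(D _) -/(D _).
  rewrite (D0 _ (DAJ _ Av)) -/(D (J _)) (D0 _ (J_derivedJ (DAJ _ Av))).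
  move=> /(_ erefl erefl); rewrite (lieC v) /D lieNr dotNl; lra.
suff Dz z : z \in A -> {in s, forall u, weight u (J z) = 0} -> D z = 0.
  move=> z Az; have [v Av [sv ->]] := aff_family_split smax.1 Az.
  rewrite lieDr [lie _ v]Dz // add0r big_seq.
  elim/big_rec: _ => [|u t su t0]; first by rewrite lie0r.
  by rewrite lieDr t0 lieZr [lie _ u]Du // scaler0 addr0.
move=> Az sz; pose E := ad (J z).
have EE v : E v = lie (J z) v by rewrite /E adE.
(* [E] is nilpotent on [AJ]: [-2] times an eigenvalue is the value at [z] of a character, which is
   zero by maximality. *)
have [||N EN] := @nilpotent_of_eigenvalues _ _ E (@eigP (J z)) AJ.
- by apply/subvP => _ /memv_imgP[q AJq ->]; rewrite EE lie_mem_derivedJ.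
- move=> a q AJq nq; rewrite EE => zq; pose S := (AJ :&: lker (E - a *: \1%VF))%VS.
  have SE v : (v \in S) = (v \in AJ) && (lie (J z) v == a *: v).
    rewrite /S memv_cap memv_ker add_lfunE opp_lfunE scale_lfunE id_lfunE EE.
    by rewrite subr_eq0.
  have [|||v [+ nv vP]] := @joint_eigenvector (J @: A)%VS S.
  + by apply: contra_neq nq => S0; apply/eqP; rewrite -memv0 -S0 SE AJq zq /=.
  + by apply: subv_trans (capvSl _ _) (capvSl _ _).
  + move=> _ v /memv_imgP[w Aw ->]; rewrite !SE => /andP[AJv /eqP zv].
    have Av : v \in A by move: AJv; rewrite mem_derivedJ => /andP[].
    by rewrite lie_mem_derivedJ //= (lieCA g2) // zv lieZr.
  rewrite SE => /andP[AJv /eqP zv].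
  have {}vP : J_eigenvector v by move=> w Aw; apply: vP; apply: memv_img.
  have := maximal_character smax (character_weight_derivedJ AJv nv vP) Az sz.
  by rewrite (weightE nv zv); lra.
have iterA k v : v \in A -> iter k E v \in A.
  by case: k => //= k _; rewrite EE.
have DE k v : v \in A -> D (iter k E v) = iter k E (D v).
  by elim: k => //= k IH Av; rewrite -IH // !EE /D (lieCA g2) // iterA.
have Dmul k v : v \in A -> D (lie (J (iter k E z)) v) = iter k.+1 E (D v).
  elim: k v => [|k IH] v Av; first by rewrite /= EE /D (lieCA g2).
  have Ak := iterA k z Az.
  (* [D] kills [AJ], so under [D] the product is commutative. *)
  have DC a b : a \in A -> b \in A -> D (lie (J a) b) = D (lie (J b) a).
    move=> Aa Ab; apply/eqP; rewrite -subr_eq0 /D -lieBr.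
    by apply/eqP/D0/lieJ_sym.
  rewrite DC //= ?EE // (lieCA g2 (J v)) // {1}/D (lieCA g2) // -/(D _) DC //.
  by rewrite IH // -!EE.
have down k : (forall j, (k <= j)%N -> iter j E (D z) = 0) -> D z = 0.
  elim: k => [/(_ 0%N)/(_ isT)//|k IH] h; apply: IH => j.
  rewrite leq_eqVlt => /predU1P[<-|]; last exact: h.
  apply: (@dot_eq0 _ _ m); rewrite -DE // Dsq ?iterA // Dmul ?iterA // DE //.
  by rewrite -iterD h ?dot0l // addSn ltnS leq_addr.
apply: (down N) => j Nj; rewrite -(subnK Nj) iterD EN ?DAJ //.
by elim: (j - N)%N => //= k ->; rewrite linear0.
Qed.

(** By [weightJ_lie] every character vanishes on [w = [y, J y]]. If [x] is in [AJ], or if its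
    character is zero on the whole family, the SKT equation becomes a vanishing sum of squares.
    Otherwise [x] is proportional to a member of the family. *)
Lemma weight_complement s x y : maximal_family s -> x \in A -> x != 0 ->
    eigenvector x ->
    {in s, forall u, weight u y = 0 /\ weight u (J y) = 0} ->
  weight x y = 0.
Proof.
move=> smax Ax nx xP sy; have [[us sP sO] _] := smax.
set w := lie y (J y); have Aw : w \in A by apply: A_lie.
have sw : {in s, forall u, weight u (J w) = 0}.
  move=> u su; have [Au nu uP uu] := sP u su; have [y0 Jy0] := sy u su.
  by rewrite weightJ_lie // y0 Jy0 mul0r mul0r subrr.
apply: sqr_weight0 => //.
case: (boolP (x \in AJ)) => AJx.
  have := maximal_character smax
    (character_weight_derivedJ AJx nx (eigenvector_J xP)) Aw sw.
  move=> chi0; have w0 : weight x (J w) = 0 by lra.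
  have := SKT_eigenvector_derivedJ y AJx xP; rewrite -/w w0 mul0r.
  have := dot_ge0 m (lie y (J x) + weight x (J y) *: x); lra.
have chi := character_weight Ax AJx (eigenvector_J xP).
case: (boolP (all (fun u => weight x (J u) == 0) s)) => [/allP s0|].
  have x0 : {in A, forall z, weight x (J z) = 0}.
    move=> z Az; have [v Av [sv ->]] := aff_family_split smax.1 Az.
    rewrite JD weightD (maximal_character smax chi Av sv) add0r.
    rewrite weight_sum; last exact: eigenvector_J.
    by rewrite big_seq big1 // => u su; rewrite (eqP (s0 u su)) mulr0.
  have D0 := derived_centralised smax Ax AJx xP x0.
  have AJp := lieJ_eigenvector y Ax xP.
  have A_ q : q \in AJ -> q \in A by rewrite mem_derivedJ => /andP[].
  have := @SKT_eigenvector x y Ax xP (x0 _ Ax).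
  rewrite -/w (D0 w) // (D0 _ (A_ _ AJp)) (D0 _ (A_ _ (J_derivedJ AJp))).
  rewrite (x0 _ Aw) dot0l mul0r addr0 => /(_ erefl erefl).
  by move=> /eqP; rewrite addr_eq0 => /eqP ->; rewrite oppr_le0 dot_ge0.
case/allPn => u su nu; have [Au nzu uP uu] := sP u su.
set t := weight x (J u) in nu; have AJu := idempotent_notin Au nzu uu.
have AJq := eigenvector_sym Ax Au xP uP; rewrite -/t in AJq.
set q := (X in X \in _) in AJq.
have uq : lie (J u) q = (t * t) *: x - weight u (J x) *: u.
  by rewrite /q lieBr !lieZr xP -/t scalerA uu.
(* [t] is the value of a character at an idempotent. Once [t = 1], [q] is fixed by [ad (J u)] and
   thus zero. *)
have t1 : t = 1.
  apply: (mulIf nu); rewrite mul1r; apply/eqP; rewrite -subr_eq0; apply/eqP.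
  apply: (scale_memN _ AJx).
  have -> : (t * t - t) *: x = lie (J u) q - q.
    by rewrite uq; apply: (dot_inj (m := m)) => v; rewrite /q !dotE; ring.
  by rewrite memvB ?lie_mem_derivedJ.
have : q = 0.
  by apply: (derivedJ_fixed Au uu AJq); rewrite uq /q t1 mulr1.
rewrite /q t1 scale1r => /eqP; rewrite subr_eq0 => /eqP xu.
have [y0 Jy0] := sy u su.
have x0 v : weight u v = 0 -> weight x v = 0.
  by move=> v0; apply: weightE => //; rewrite xu lieZr uP v0 !(scale0r, scaler0).
by rewrite !x0 // expr0n addr0 mul0r.
Qed.

(** * Nilpotent ideals *)

(** An eigenspace of [ad y] in [A] is stable under all of [ad g], so its eigenvalue is the weight of
    a joint eigenvector. *)
Lemma ad_nilpotent_of_weights y :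
    (forall x, x \in A -> x != 0 -> eigenvector x -> weight x y = 0) ->
  exists N, {in A, forall v, iter N (ad y) v = 0}.
Proof.
move=> wy; apply: (nilpotent_of_eigenvalues (@eigP y)).
  by apply/subvP => _ /memv_imgP[v _ ->]; rewrite adE.
move=> a v Av nv; rewrite adE => yv.
pose S := (A :&: lker (ad y - a *: \1%VF))%VS.
have SE w : (w \in S) = (w \in A) && (lie y w == a *: w).
  by rewrite /S memv_cap memv_ker add_lfunE opp_lfunE scale_lfunE id_lfunE adE subr_eq0.
have [|||x [+ nx xP]] := @joint_eigenvector fullv S.
- by apply: contra_neq nv => S0; apply/eqP; rewrite -memv0 -S0 SE Av yv /=.
- exact: capvSl.
- by move=> z w _; rewrite !SE => /andP[Aw /eqP yw]; rewrite A_lie /= (lieCA g2) // yw lieZr.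
rewrite SE => /andP[Ax /eqP yx]; rewrite -(weightE nx yx).
by apply: wy => // z; apply: xP (memvf _).
Qed.

(** Iterating [L <= ad e L + M], with [M] the sum over the other elements, gives [L <= M] as [ad e]
    is nilpotent; this removes [e] from the list. *)
Lemma nilpotent_common_image (l : seq g) (L : {vspace g}) :
    (L <= A)%VS ->
    {in l, forall e, (ad e @: L <= L)%VS} ->
    {in l, forall e, exists N, {in A, forall v, iter N (ad e) v = 0}} ->
  (L <= \sum_(e <- l) ad e @: L)%VS -> L = 0%VS.
Proof.
move=> LA; elim: l => [|e l IH] lL lN; first by rewrite big_nil subv0 => /eqP.
have sl : {subset l <= e :: l} by move=> x lx; rewrite inE lx orbT.
have {}IH := IH (sub_in1 sl lL) (sub_in1 sl lN).
rewrite big_cons; set M := (\sum_(_ <- l) _)%VS => LM; apply: IH; rewrite -/M.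
have eM : (ad e @: M <= M)%VS.
  rewrite /M limg_sum; elim: (l) => [|x l' IH']; first by rewrite !big_nil sub0v.
  rewrite !big_cons addvS //; apply/subvP => _ /memv_imgP[_ /memv_imgP[v Lv ->] ->].
  have Av := subvP LA _ Lv; rewrite !adE (lieCA g2) // -!adE memv_img //.
  by apply: (subvP (lL e (mem_head _ _))); apply: memv_img.
have LkM k : (L <= iter k (lfun_img (ad e)) L + M)%VS.
  elim: k => [|k IH] /=; first exact: addvSl.
  apply: subv_trans LM _; rewrite subv_add addvSr andbT.
  by apply: subv_trans (limgS _ IH) _; rewrite limgD addvS.
have [N N0] := lN e (mem_head _ _).
suff iN0 : iter N (lfun_img (ad e)) L = 0%VS by move: (LkM N); rewrite iN0 add0v.
apply/eqP; rewrite -subv0; apply/subvP => _ /iter_limgP[v Lv ->].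
by rewrite memv0 N0 // (subvP LA).
Qed.

Lemma mem_liev (U V : {vspace g}) u v : u \in U -> v \in V -> lie u v \in liev U V.
Proof. by have /lievP := subvv (liev U V); apply. Qed.

Lemma liev_sum (U V : {vspace g}) :
  (liev U V <= \sum_(u <- vbasis U) ad u @: V)%VS.
Proof.
apply/span_subvP => _ /allpairsP[[u v] /= [Uu Vv ->]].
rewrite (big_rem u) //=; apply: (subvP (addvSl _ _)).
by rewrite -adE memv_img // vbasis_mem.
Qed.

(** A stationary term [L] of the lower central series satisfies [L = [I, L]], so it lies in [A],
    where commuting nilpotent operators force [L = 0]. *)
Lemma ideal_nilpotent (I : {vspace g}) : is_ideal I ->
    (forall x y, y \in I -> x \in A -> x != 0 -> eigenvector x -> weight x y = 0) ->
  is_nilpotent I.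
Proof.
move=> Iid wI; have [|k Lk] := @vspace_chain_stationary _ _ (lower_central I).
  elim=> [|k IH].
    by apply/lievP => u v _ Iv; have /lievP := Iid; apply=> //; apply: memvf.
  by apply/lievP => u v Iu Lv; apply: mem_liev => //; apply: (subvP IH).
exists k; set L := lower_central I k in Lk *.
have LA : (L <= A)%VS by rewrite -Lk; apply/lievP => u v _ _; apply: A_lie.
apply: (@nilpotent_common_image (vbasis I)) => // [e /vbasis_mem Ie|e /vbasis_mem Ie|].
- apply/subvP => _ /memv_imgP[v Lv ->]; rewrite adE -Lk; exact: mem_liev.
- by apply: ad_nilpotent_of_weights => x *; apply: wI.
- by rewrite -{1}Lk; apply: liev_sum.
Qed.

(** [x] may lie outside [I]; a first bracket with [y] brings it in, hence the exponent [k.+1]. *)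
Lemma nilpotent_ideal_weight (I : {vspace g}) x y : is_ideal I -> is_nilpotent I ->
  y \in I -> x != 0 -> eigenvector x -> weight x y = 0.
Proof.
move=> /lievP Iid [k Ik] Iy nx xP.
have : weight x y ^+ k.+1 *: x \in lower_central I k.
  elim: k {Ik} => [|k IH].
    by rewrite expr1 -xP lieC memvN; apply: Iid => //; apply: memvf.
  by rewrite exprSr -scalerA -xP -lieZr; apply: mem_liev.
by rewrite Ik memv0 scaler_eq0 (negPf nx) orbF expf_eq0 /= => /eqP.
Qed.

(** * Maximal families and their centralisers *)

(** [ad (J x)] fixes [x] and kills the other members, hence their span. *)
Lemma aff_family_free s : aff_family s -> free s.
Proof.
elim: s => [|x s IH] [us sP sO]; first exact: nil_free.
have sub : {subset s <= x :: s} by move=> u su; rewrite inE su orbT.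
have [Ax nx _ xx] := sP x (mem_head _ _).
move: us => /= /andP[xs us].
rewrite free_cons IH ?andbT; last first.
  by split=> // [u /sub/sP//|u v /sub su /sub sv]; apply: sO.
apply: contraNN nx => sx; rewrite -xx -adE -memv_ker; apply: subvP sx.
apply/span_subvP => u su; rewrite memv_ker adE sO ?mem_head ?sub //.
by apply: contraNneq xs => ->.
Qed.

Lemma maximal_family_exists : exists s, maximal_family s.
Proof.
suff grow n : (exists s, maximal_family s) \/
    exists2 s, aff_family s & size s = n.
  case: (grow (\dim {:g}).+1) => // -[s /aff_family_free/eqP ds sn].
  by have := dimvS (subvf <<s>>); rewrite ds sn ltnn.
elim: n => [|n [?|[s sP <-]]]; first by right; exists [::].
  by left.
case: (EM (exists x, aff_family (x :: s))) => [[x xs]|ns].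
  by right; exists (x :: s).
by left; exists s; split=> // x xs; apply: ns; exists x.
Qed.

(** The ideal [m], written with kernels: for a nonzero eigenvector [u], [weight u y = 0] means
    [lie u y = 0]. *)
Definition centraliser s : {vspace g} :=
  foldr (fun u V => lker (ad u) :&: lker (ad u \o J) :&: V)%VS fullv s.

Lemma centraliserP s y : aff_family s ->
  reflect {in s, forall u, weight u y = 0 /\ weight u (J y) = 0}
          (y \in centraliser s).
Proof.
move=> [_ sP _]; have uP u z : u \in s -> (lie u z == 0) = (weight u z == 0).
  by move=> /sP[_ nu uP _]; rewrite lieC uP oppr_eq0 scaler_eq0 (negPf nu) orbF.
have -> : (y \in centraliser s) = all (fun u => (lie u y == 0) && (lie u (J y) == 0)) s.
  elim: (s) => [|u s' IH] /=; first exact: memvf.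
  by rewrite !memv_cap !memv_ker comp_lfunE !adE IH.
apply: (iffP allP) => sy u su; have := sy u su; rewrite !uP //.
  by case/andP=> /eqP-> /eqP->.
by case=> -> ->; rewrite eqxx.
Qed.

Lemma J_centraliser s y : aff_family s -> y \in centraliser s -> J y \in centraliser s.
Proof.
move=> sP /(centraliserP _ sP) ys; apply/centraliserP => // u /ys[y0 Jy0].
by rewrite JJ weightN y0 oppr0.
Qed.

Lemma centraliser_ideal s : aff_family s -> is_ideal (centraliser s).
Proof.
move=> sP; apply/lievP => z y _ /(centraliserP _ sP) ys; apply/centraliserP => // u su.
have [Au nu uP uu] := let: And3 _ h _ := sP in h u su; have [y0 Jy0] := ys u su.
by rewrite (weight_derived Au) ?A_lie // weightJ_lie // y0 Jy0 !mulr0 subr0.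
Qed.

(** * The subalgebra [aff(R)^p] *)

Lemma linear_hom (V W : vectType R) (f : V -> W) : linear f ->
  exists F : 'Hom(V, W), F =1 f.
Proof.
move=> fL; pose L := GRing.isLinear.Build R V W *:%R f fL.
pose F : {linear V -> W} := HB.pack f L.
by exists (linfun F) => x; rewrite lfunE.
Qed.

Definition aff_sum p (X : 'I_p -> g) (v : affp R p) : g :=
  \sum_i ((v i).1 *: X i + (v i).2 *: J (X i)).

Section AffMap.
Variables (p : nat) (X : 'I_p -> g).
Hypothesis XA : forall i, X i \in A.
Hypothesis JXX : forall i j, lie (J (X i)) (X j) = (i == j)%:R *: X j.

Let XX i j : lie (X i) (X j) = 0. Proof. exact: lie_derived. Qed.
Let XJX i j : lie (X i) (J (X j)) = - ((i == j)%:R *: X i).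
Proof. by rewrite lieC JXX eq_sym. Qed.
Let JXJX i j : lie (J (X i)) (J (X j)) = 0.
Proof.
rewrite lieJJ XX JXX XJX JN add0r.
by case: eqVneq => [->|_]; rewrite ?subrr // !scale0r linear0 subrr.
Qed.

Lemma aff_sum_linear : linear (aff_sum X).
Proof.
move=> k u v; rewrite /aff_sum scaler_sumr -big_split; apply: eq_bigr => i _.
rewrite !ffunE; apply: (dot_inj (m := m)) => z /=; rewrite !dotE.
by rewrite /GRing.scale /=; ring.
Qed.

Lemma aff_sum_J v : aff_sum X (affp_J v) = J (aff_sum X v).
Proof.
rewrite /aff_sum linear_sum; apply: eq_bigr => i _.
by rewrite ffunE /= JD !JZ JJ scalerN scaleNr addrC.
Qed.

Lemma lie_aff_sum_l v j : lie (aff_sum X v) (X j) = (v j).2 *: X j.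
Proof.
rewrite /aff_sum lie_suml (bigD1 j) //= big1 => [|i /negPf nij].
  by rewrite !lieE XX JXX eqxx scaler0 scale1r addr0 add0r.
by rewrite !lieE XX JXX nij scale0r !scaler0 addr0.
Qed.

Lemma lie_aff_sum u v : aff_sum X (lie u v) = lie (aff_sum X u) (aff_sum X v).
Proof.
rewrite [in RHS]/aff_sum lie_sumr -/(aff_sum X u); apply: eq_bigr => j _.
rewrite lieDr !lieZr lie_aff_sum_l.
rewrite /aff_sum lie_suml (bigD1 j) //= big1 => [|i /negPf nij].
  rewrite !lieE JXJX XJX eqxx.
  have -> : (lie u v) j = ((u j).2 * (v j).1 - (u j).1 * (v j).2, 0).
    by rewrite [lie u v]/(ffun_lie u v) ffunE.
  by apply: (dot_inj (m := m)) => z; rewrite !dotE /=; ring.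
by rewrite !lieE JXJX XJX nij scale0r oppr0 !scaler0 addr0.
Qed.

End AffMap.

(** The weights of [X j] at [J (f v)] and [f v] are the two coordinates of [v j]. They show that [f]
    is injective, that its image meets the centraliser in 0, and how to project onto this image. *)
Lemma aff_decomposition s : aff_family s ->
  affp_semidirect J (size s) (centraliser s).
Proof.
move=> sP; split; first exact: centraliser_ideal.
have [us fP fO] := sP; pose X (i : 'I_(size s)) := s`_i.
have sX i : X i \in s by apply: mem_nth.
have XA i : X i \in A by case: (fP _ (sX i)).
have JXX i j : lie (J (X i)) (X j) = (i == j)%:R *: X j.
  case: eqVneq => [->|nij]; first by case: (fP _ (sX j)) => _ _ _ ->; rewrite scale1r.
  by rewrite scale0r fO // /X nth_uniq.
have [f fE] := linear_hom (aff_sum_linear X).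
have fJ u : f (affp_J u) = J (f u) by rewrite !fE aff_sum_J.
have flie u v : f (lie u v) = lie (f u) (f v) by rewrite !fE lie_aff_sum.
have wf v j : weight (X j) (f v) = (v j).2.
  have [_ nX _ _] := fP _ (sX j).
  by apply: weightE => //; rewrite fE lie_aff_sum_l.
have wJf v j : weight (X j) (J (f v)) = (v j).1 by rewrite -fJ wf ffunE.
have f0 v : f v \in centraliser s -> v = 0.
  move/(centraliserP _ sP) => fv; apply/ffunP => j; rewrite ffunE.
  have [] := fv _ (sX j); rewrite wf wJf; case: (v j) => a b /= -> ->.
  by [].
exists (limg f); split.
- by apply/lievP => _ _ /memv_imgP[u _ ->] /memv_imgP[v _ ->]; rewrite -flie memv_img ?memvf.
- by apply/subvP => _ /memv_imgP[_ /memv_imgP[u _ ->] ->]; rewrite -fJ memv_img ?memvf.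
- exists f; split=> //; apply/eqP; rewrite -subv0; apply/subvP => v.
  by rewrite memv_ker memv0 => /eqP v0; apply/eqP/f0; rewrite v0 mem0v.
- apply: subv_anti; rewrite subvf /=; apply/subvP => y _.
  pose v : affp R (size s) := [ffun i => (weight (X i) (J y), weight (X i) y)].
  rewrite -(subrKC (f v) y) memv_add ?memv_img ?memvf //; apply/centraliserP => // u su.
  have [i ->] : exists i, u = X i.
    by exists (Ordinal (eq_ind_r is_true su (index_mem u s))); rewrite /X /= nth_index.
  by rewrite JD JN !weightD !weightN wf wJf !ffunE /= !subrr.
- apply/eqP; rewrite -subv0; apply/subvP => y.
  rewrite memv_cap memv0 => /andP[/memv_imgP[v _ ->] /f0 ->].
  by rewrite linear0.
Qed.

(** * The nilradical and the [J]-series *)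

(** All weights vanish on the ideal [n + centraliser s], so it is nilpotent and equals [n].
    Conversely, weights vanish on [n], so [y] and [J y] in [n] put [y] in the centraliser. *)
Lemma nilradical_complex_part s (n : {vspace g}) : maximal_family s ->
  is_nilradical n -> (n :&: J @: n)%VS = centraliser s.
Proof.
move=> smax [nid nnil nmax]; have sP := smax.1; have [_ fP _] := sP.
have idI : is_ideal (n + centraliser s)%VS.
  apply/lievP => z _ _ /memv_addP[y ny [w cw ->]]; rewrite lieDr memv_add //.
    by have /lievP := nid; apply=> //; apply: memvf.
  by have /lievP := centraliser_ideal sP; apply=> //; apply: memvf.
have cn : (centraliser s <= n)%VS.
  rewrite -(nmax (n + centraliser s)%VS) ?addvSl ?addvSr //.
  apply: ideal_nilpotent => // x _ /memv_addP[y ny [w cw ->]] Ax nx xP.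
  rewrite weightD (nilpotent_ideal_weight nid nnil ny nx xP) add0r.
  by apply: (weight_complement smax) => //; apply/centraliserP.
apply: subv_anti; apply/andP; split; apply/subvP => y.
  rewrite memv_cap => /andP[ny /memv_imgP[z nz yz]]; apply/centraliserP => // u su.
  have [Au nu uP _] := fP u su.
  rewrite yz JJ weightN -{1}yz !(nilpotent_ideal_weight nid nnil _ nu uP) ?oppr0 //.
move=> cy; rewrite memv_cap (subvP cn) //=; apply/memv_imgP; exists (- J y).
  by rewrite memvN (subvP cn) // J_centraliser.
by rewrite JN JJ opprK.
Qed.

(** [x = [J x, x]] keeps [x] in the next term, and [J x] follows since that term includes the
    [J]-image of the brackets. *)
Lemma aff_family_J_series s x k : aff_family s -> x \in s -> x \in J_series J k.
Proof.
move=> [_ sP _] /sP[_ _ _ xx].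
suff : (x \in J_series J k) && (J x \in J_series J k) by case/andP.
elim: k => [|k /andP[Vx VJx]]; first by rewrite !memvf.
have xV : x \in liev (J_series J k) (J_series J k) by rewrite -{1}xx mem_liev.
by rewrite /= (subvP (addvSl _ _)) //= (subvP (addvSr _ _)) // memv_img.
Qed.

End SKTLie.

Theorem theorem5p10 (R : realType) :
  (forall (g : lieAlgType R) (J : 'End(g)),
    unimodular g -> two_step_solvable g -> completely_solvable g ->
    complex_structure J -> J_solvable J ->
    (exists m : {dot g for idfun}, SKT J m) ->
    lie_nilpotent g)
  /\
  (forall (g : lieAlgType R) (J : 'End(g)),
    unimodular g -> two_step_solvable g -> completely_solvable g ->
    complex_structure J ->
    (exists m : {dot g for idfun}, SKT J m) ->
    forall n : {vspace g}, is_nilradical n ->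
    exists p : nat, affp_semidirect J p (n :&: J @: n)%VS).
Proof.
split=> g J _ g2 gcs JP.
  case=> k Jk [m mP]; have eigP := completely_solvable_ad gcs.
  have [s smax] := maximal_family_exists J m.
  have s0 : s = [::].
    case: s smax => // x s [sP _]; have [_ /(_ x (mem_head _ _))[_ nx _ _] _] := sP.
    have := aff_family_J_series k sP (mem_head _ _).
    by rewrite Jk memv0 (negPf nx).
  (* For the empty family [weight_complement] applies to every [y], so all weights vanish on [g]. *)
  apply: (ideal_nilpotent (m := m) g2 eigP); first exact: subvf.
  move=> x y _ Ax nx xP; apply: (weight_complement g2 JP mP eigP smax) => //.
  by rewrite s0.
case=> m mP n nP; have eigP := completely_solvable_ad gcs.
have [s smax] := maximal_family_exists J m.
exists (size s); rewrite (nilradical_complex_part g2 JP mP eigP smax nP).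
exact: (aff_decomposition g2 JP mP smax.1).
Qed.
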